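(* Let $\mathcal D\in\mathcal{CU}_\mu(\mathcal H)$ be a diagonal operator. Then $\mathfrak H(\mathcal D)=\mathfrak h(\mathcal D)=0$.
   Context: Let $\mu_j>0$ ($j\in\mathbb N_0=\{0,1,\dots\}$) with $\sum_j\mu_j=1$. $\mathcal H=l^2(\mathbb N_0,\mu)$ is the Hilbert space of complex sequences with $\langle x,y\rangle=\sum_j\mu_jx_j\overline{y_j}$, $\|x\|=\sqrt{\langle x,x\rangle}$. $\mathcal{CU}_\mu(\mathcal H)$ is the set of bounded linear operators $U$ on $\mathcal H$ with $\|Ux\|\le\|x\|$ for all $x$. A diagonal operator is $(x_j)\mapsto(d_jx_j)$. Matrix entries: $(Ux)_j=\sum_kU_{jk}x_k$. Put $\mathbf B=b(U)$, $\mathbf B_{jk}=\frac{\mu_j}{\mu_k}|U_{jk}|^2$; convention $0\log0=0$. Entropy $\mathfrak h(U)$: for a finite partition $\chi=\{X_0,\dots,X_K\}$ of $\mathbb N_0$, $n\ge1$ and $\sigma\in\mathcal S_{n,K}$ (maps $\{0,\dots,n\}\to\{0,\dots,K\}$) put $$\mathcal I_U(\mathbf G_\sigma)=\sum_{j_0,\dots,j_n\in\mathbb N_0}\mathbf 1_{X_{\sigma(n)}}(j_n)\,\mathbf B_{j_nj_{n-1}}\mathbf 1_{X_{\sigma(n-1)}}(j_{n-1})\cdots\mathbf B_{j_1j_0}\mathbf 1_{X_{\sigma(0)}}(j_0)\,\mu_{j_0},$$ $\mathfrak h(U,\chi,n)=-\sum_{\sigma\in\mathcal S_{n,K}}\mathcal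 I_U(\mathbf G_\sigma)\log\mathcal I_U(\mathbf G_\sigma)$, $\mathfrak h(U,\chi)=\lim_{n\to\infty}\frac1n\mathfrak h(U,\chi,n)$ (when it exists), $\mathfrak h(U)=\sup_\chi\mathfrak h(U,\chi)$. $\mathfrak H(U)$: let $\mathbf B_J=(\mathbf B_{jk})_{0\le j,k<J}$ and let $\mathcal P_J$ be the projection of $\mathbb C^J$ onto $\mathrm{Ker}(\mathbf B_J-I)$ along $\mathrm{Im}(\mathbf B_J-I)$. Put $\mathfrak h(U_J)=-\sum_{j,k=0}^{J-1}(\mathcal P_J^Te)_j(\mathbf B_J)_{jk}(\mathcal P_J\mu^{(J)})_k\log(\mathbf B_J)_{jk}$ with $e=(1,\dots,1)$, $\mu^{(J)}=(\mu_0,\dots,\mu_{J-1})$ (the entropy of the truncation $U_J=(U_{jk})_{j,k<J}$ on $\mathbb C^J$), and $\mathfrak H(U)=\lim_{J\to\infty}\mathfrak h(U_J)$. *)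

(* Defs.v *)
From HB Require Import structures.
From mathcomp Require Import all_boot all_order all_algebra.
From mathcomp Require Import all_classical all_reals all_analysis.
From mathcomp Require Import complex ring.

Set Implicit Arguments.
Unset Strict Implicit.
Unset Printing Implicit Defensive.

Import Order.TTheory GRing.Theory Num.Theory.
Import numFieldNormedType.Exports.
Local Open Scope classical_set_scope.
Local Open Scope ring_scope.
Local Open Scope complex_scope.

Record weight (R : realType) := Weight {
  wt :> nat -> R ;
  wt_gt0 : forall j, 0 < wt j ;
  wt_sum1 : \esum_(j in [set: nat]) (wt j)%:E = 1%E }.

Definition sqmod (R : realType) (z : R[i]) : R := ComplexField.Normc.normc z ^+ 2.

Lemma sqmod_ge0 (R : realType) (z : R[i]) : 0 <= sqmod z.
Proof. exact: sqr_ge0. Qed.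

Lemma sqmod0 (R : realType) : sqmod (0 : R[i]) = 0.
Proof. by rewrite /sqmod ComplexField.Normc.normc0 expr0n. Qed.

Lemma sqmodM (R : realType) (z w : R[i]) : sqmod (z * w) = sqmod z * sqmod w.
Proof. by rewrite /sqmod ComplexField.Normc.normcM exprMn. Qed.

Lemma sqmodE (R : realType) (z : R[i]) :
  sqmod z = complex.Re z ^+ 2 + complex.Im z ^+ 2.
Proof.
by case: z => a b; rewrite /sqmod /= sqr_sqrtr // addr_ge0 // sqr_ge0.
Qed.

Lemma sqmodD (R : realType) (z w : R[i]) :
  sqmod (z + w) <= 2 * (sqmod z + sqmod w).
Proof.
have sq (s t : R) : (s + t) ^+ 2 <= 2 * (s ^+ 2 + t ^+ 2).
  rewrite -subr_ge0; have -> : 2 * (s ^+ 2 + t ^+ 2) - (s + t) ^+ 2 = (s - t) ^+ 2.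
    by ring.
  exact: sqr_ge0.
rewrite !sqmodE /=; case: z => a b; case: w => c d /=.
by rewrite addrACA mulrDr lerD.
Qed.

Section HilbertSpace.
Context {R : realType} (mu : weight R).

Definition sqnorm (x : nat -> R[i]) : \bar R :=
  (\esum_(j in [set: nat]) (mu j * sqmod (x j))%:E)%E.

Definition l2 : {pred (nat -> R[i])} := mem [set x | (sqnorm x < +oo)%E].

Lemma sqnorm_term_ge0 (x : nat -> R[i]) j : (0 <= (mu j * sqmod (x j))%:E)%E.
Proof. by rewrite lee_fin mulr_ge0 ?sqmod_ge0 // ltW // wt_gt0. Qed.

Lemma sqnormZ (a : R[i]) (x : nat -> R[i]) :
  sqnorm (a *: x) = ((sqmod a)%:E * sqnorm x)%E.
Proof.
rewrite /sqnorm -!nneseries_esumT; last 2 first.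
- by move=> j; exact: sqnorm_term_ge0.
- by move=> j; exact: sqnorm_term_ge0.
rewrite -nneseriesZl; last by move=> j _; exact: sqnorm_term_ge0.
apply: eq_eseriesr => j _; rewrite -EFinM; congr EFin.
by rewrite [(a *: x) j]/(a * x j) sqmodM mulrCA.
Qed.

Lemma sqnormD (x y : nat -> R[i]) :
  (sqnorm (x + y)%R <= 2%:E * (sqnorm x + sqnorm y))%E.
Proof.
rewrite /sqnorm -esumD; [|by move=> j _; exact: sqnorm_term_ge0..].
rewrite -!nneseries_esumT; last 2 first.
- by move=> j; rewrite adde_ge0 // sqnorm_term_ge0.
- by move=> j; exact: sqnorm_term_ge0.
rewrite -nneseriesZl; last by move=> j _; rewrite adde_ge0 // sqnorm_term_ge0.
apply: lee_nneseries => j _; first by move=> *; exact: sqnorm_term_ge0.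
rewrite -EFinD -EFinM lee_fin -mulrDr [leRHS]mulrCA.
by apply: ler_wpM2l; [exact/ltW/wt_gt0|exact: sqmodD].
Qed.

Lemma sqnorm0 : sqnorm 0 = 0%E.
Proof. by apply: esum1 => j _; rewrite sqmod0 mulr0. Qed.

Lemma l2_submod_closed : submod_closed l2.
Proof.
split=> [|a x y]; rewrite !inE /=; first by rewrite sqnorm0 ltry.
move=> xoo yoo; apply: (le_lt_trans (sqnormD _ _)).
rewrite sqnormZ lte_mul_pinfty ?lee_fin //.
by rewrite lte_add_pinfty // lte_mul_pinfty // lee_fin sqmod_ge0.
Qed.

HB.instance Definition _ :=
  GRing.isSubmodClosed.Build R[i] (nat -> R[i]) l2 l2_submod_closed.

(** $l^2(\mathbb N_0,\mu)$ as a complex vector space *)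
Record hilb := Hilb { seq_of :> nat -> R[i] ; _ : seq_of \in l2 }.

HB.instance Definition _ := [isSub for seq_of].
HB.instance Definition _ := [Choice of hilb by <:].
HB.instance Definition _ := [SubChoice_isSubLmodule of hilb by <:].

(** [sqnorm x] is $\langle x,x\rangle=\sum_j\mu_j|x_j|^2$, finite on [hilb]. *)
Definition l2norm (x : hilb) : R := Num.sqrt (fine (sqnorm x)).

Definition delta (k : nat) : nat -> R[i] := fun j => (j == k)%:R.

Lemma delta_l2 k : delta k \in l2.
Proof.
rewrite inE /= /sqnorm.
rewrite (_ : \esum_(j in _) _ = \esum_(j in [set k]) (mu j * sqmod (delta k j))%:E)%E.
  by rewrite esum_set1 ?ltry // sqnorm_term_ge0.
rewrite [RHS]esum_mkcond; apply: eq_esum => j _.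
rewrite /delta; case: ifPn => //; rewrite notin_setE /= => /eqP/negbTE ->.
by rewrite sqmod0 mulr0.
Qed.

Definition basis (k : nat) : hilb := Hilb (delta_l2 k).

End HilbertSpace.

Section Operators.
Context {R : realType} {mu : weight R}.
Implicit Type U : {linear hilb mu -> hilb mu}.

(** $U\in\mathcal{CU}_\mu(\mathcal H)$; the bound also gives boundedness *)
Definition contractive U := forall x, l2norm (U x) <= l2norm x.

Definition diagonal_op U :=
  exists d : nat -> R[i], forall (x : hilb mu) (j : nat), U x j = d j * x j.

Definition entry U (j k : nat) : R[i] := U (basis mu k) j.

Definition bmat U (j k : nat) : R := mu j / mu k * sqmod (entry U j k).

End Operators.

Record fin_partition := FinPartition {
  last_block : nat ;
  block :> 'I_last_block.+1 -> set nat ;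
  _ : partition [set: 'I_last_block.+1] block [set: nat] }.

Section Entropy.
Context {R : realType} {mu : weight R}.
Implicit Type U : {linear hilb mu -> hilb mu}.

(** The sum of the nonnegative terms over $(j_0,\dots,j_n)\in\mathbb N_0^{n+1}$. *)
Definition path_weight U (chi : fin_partition) (n : nat)
    (sigma : {ffun 'I_n.+1 -> 'I_(last_block chi).+1}) : R :=
  fine (\esum_(j in [set: {ffun 'I_n.+1 -> nat}])
    ((\prod_(i < n.+1) \1_(chi (sigma i)) (j i)) *
     (\prod_(i < n) bmat U (j (lift ord0 i)) (j (widen_ord (leqnSn n) i))) *
     mu (j ord0))%:E)%E.

(** [ln 0 = 0] in the library, hence $0\log 0=0$, here and in [trunc_entropy]. *)
Definition entropy_n U (chi : fin_partition) (n : nat) : R :=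
  - \sum_(sigma : {ffun 'I_n.+1 -> 'I_(last_block chi).+1})
      path_weight U sigma * ln (path_weight U sigma).

Definition entropy_rate U (chi : fin_partition) : R^nat :=
  fun n => n%:R^-1 * entropy_n U chi n.

(** Meaningful when [entropy_rate U chi] converges. *)
Definition entropy_part U (chi : fin_partition) : R :=
  limn (entropy_rate U chi).

Definition entropy U : \bar R :=
  ereal_sup [set (entropy_part U chi)%:E | chi in [set: fin_partition]].

Definition trunc U (J : nat) : 'M[R[i]]_J := \matrix_(j, k) (bmat U j k)%:C.

(** MathComp subspaces are row spaces, so the kernel and the image of
    [trunc U J - 1], acting on columns, are encoded through its transpose. *)
Definition trunc_ker U (J : nat) : 'M[R[i]]_J := kermx (trunc U J - 1%:M)^T.
Definition trunc_im U (J : nat) : 'M[R[i]]_J := (trunc U J - 1%:M)^T.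

(** By rank-nullity, this says that $\mathbb C^J$ is the direct sum of the two
    subspaces, i.e., that the projection below is well defined. *)
Definition trunc_direct U (J : nat) : Prop :=
  (trunc_ker U J :&: trunc_im U J = 0)%MS.

Definition trunc_proj U (J : nat) : 'M[R[i]]_J :=
  (proj_mx (trunc_ker U J) (trunc_im U J))^T.

(** $\mathfrak h(U_J)$; complex-valued because the projection acts on $\mathbb C^J$.
    [R[i]^o] is [R[i]] with the topology of the complex modulus. *)
Definition trunc_entropy U (J : nat) : R[i]^o :=
  let P := trunc_proj U J in
  let e : 'cV[R[i]]_J := const_mx 1 in
  let muJ : 'cV[R[i]]_J := \col_(k < J) (mu k)%:C in
  - \sum_(j < J) \sum_(k < J)
      (P^T *m e) j ord0 * (bmat U j k)%:C * (P *m muJ) k ord0 *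
      (ln (bmat U j k))%:C.

(** Meaningful when [trunc_direct U J] holds for all [J] and
    [trunc_entropy U] converges. *)
Definition lim_trunc_entropy U : R[i]^o := limn (trunc_entropy U).

End Entropy.

(* Main.v *)
Require Import Defs.
From HB Require Import structures.
From mathcomp Require Import all_boot all_order all_algebra.
From mathcomp Require Import all_classical all_reals all_analysis.
From mathcomp Require Import complex.
Import Order.TTheory GRing.Theory Num.Theory.
Import numFieldNormedType.Exports.
Local Open Scope classical_set_scope.
Local Open Scope ring_scope.
Local Open Scope complex_scope.

(** The matrix [bmat D] is diagonal with entries in [0, 1].  Truncations: the
    projection of [mu] lies in the kernel of [B_J - 1], so its [k]-th coordinate
    vanishes unless [B_kk = 1], and then [ln B_kk = 0]; hence every truncated
    entropy is zero.  Partitions: only constant paths have nonzero weight, so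
    only the constant [sigma] contribute, and their number does not depend on
    [n].  Since [- p ln p <= 1] on [0, 1], the [n]-step entropies are bounded by
    the number of blocks, and dividing by [n] gives rate zero. *)

Lemma entropy_term_bounds (R : realType) (p : R) :
  0 <= p <= 1 -> 0 <= - (p * ln p) <= 1.
Proof.
move=> /andP[p0 p1]; rewrite -mulrN mulr_ge0 ?oppr_ge0 ?ln_le0 //=.
move: p0; rewrite le_eqVlt => /predU1P[<-|p0]; first by rewrite mul0r.
rewrite -lnV ?posrE // mulrC -ler_pdivlMr // mul1r.
(* The inequality $\ln(1+x)\le x$ at $x=1/p-1$ gives $\ln(1/p)\le 1/p-1\le 1/p$. *)
have := @le_ln1Dx R (p^-1 - 1); rewrite (addrC 1) subrK => H.
apply: (le_trans (H _)); last by rewrite gerBl.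
by rewrite ltrBDr addNr invr_gt0.
Qed.

(** The support consists of constant functions, and [i0] makes [I] nonempty, so that a constant
    function determines its value. *)
Lemma esum_ffun_const (R : realType) (I : finType) (T : choiceType) (i0 : I)
    (a : {ffun I -> T} -> \bar R) :
  (forall f, a f != 0%E -> f = [ffun=> f i0]) ->
  (\esum_(f in [set: {ffun I -> T}]) a f =
   \esum_(x in [set: T]) a [ffun=> x])%E.
Proof.
move=> aP.
rewrite -(@esum_image _ _ _ [set: T] (fun x => [ffun=> x] : {ffun I -> T})).
  rewrite [RHS]esum_mkcond; apply: eq_esum => f _.
  case: ifPn => //; rewrite notin_setE => fN.
  by apply/eqP/negP => /negP/aP fE; apply: fN; exists (f i0).
by move=> x y _ _ /ffunP/(_ i0); rewrite !ffunE.
Qed.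

Lemma ffun_ord_const (T : Type) (n : nat) (j : {ffun 'I_n.+1 -> T}) :
  (forall i : 'I_n, j (lift ord0 i) = j (widen_ord (leqnSn n) i)) ->
  j = [ffun=> j ord0].
Proof.
move=> jS; apply/ffunP => -[m mn]; rewrite ffunE.
elim: m mn => [|m IHm] mn; first by congr (j _); exact/val_inj.
rewrite -(IHm (ltnW mn)).
have := jS (Ordinal (mn : (m < n)%N)).
by congr (j _ = j _); exact/val_inj.
Qed.

Section Diagonal.
Variables (R : realType) (mu : weight R) (D : {linear hilb mu -> hilb mu}).

Lemma sqnorm_delta k : sqnorm mu (delta k) = (mu k)%:E.
Proof.
transitivity (\esum_(j in [set k]) (mu j * sqmod (delta k j : R[i]))%:E)%E.
  rewrite [RHS]esum_mkcond; apply: eq_esum => j _.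
  case: ifPn => //; rewrite notin_setE /delta => /eqP/negbTE ->.
  by rewrite sqmod0 mulr0.
rewrite esum_set1 ?sqnorm_term_ge0 // /delta eqxx /sqmod.
by rewrite ComplexField.Normc.normc1 expr1n mulr1.
Qed.

Lemma bmat_offdiag j k : diagonal_op D -> j != k -> bmat D j k = 0.
Proof.
move=> [d Dd] jk.
by rewrite /bmat /entry Dd /= /delta (negbTE jk) mulr0 sqmod0 mulr0.
Qed.

Lemma bmat_ge0 j k : 0 <= bmat D j k.
Proof. by rewrite mulr_ge0 ?sqmod_ge0 ?divr_ge0 // ltW ?wt_gt0. Qed.

(** The $k$-th basis vector is an eigenvector with eigenvalue $d_k$ and squared norm $\mu_k$;
    contractivity there gives $|d_k|^2\le 1$, and $|d_k|^2$ is the entry. *)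
Lemma bmat_diag_le1 k : contractive D -> diagonal_op D -> bmat D k k <= 1.
Proof.
move=> Dc [d Dd].
have DbE : seq_of (D (Defs.basis mu k)) = d k *: delta k.
  apply/funext => j; rewrite Dd; change (d j * delta k j = d k * delta k j).
  by rewrite /delta; have [->//|_] := eqVneq j k; rewrite !mulr0.
have := Dc (Defs.basis mu k).
rewrite /l2norm DbE /= sqnormZ sqnorm_delta -EFinM /=.
have mu0 : 0 < mu k by exact: wt_gt0.
rewrite (ler_sqrt _ (ltW mu0)) ger_pMl // => dk.
by rewrite /bmat divff ?gt_eqF // mul1r /entry Dd /= /delta eqxx mulr1.
Qed.

Hypotheses (Dc : contractive D) (Dd : diagonal_op D).

Lemma trunc_subr1_diag J (v : 'rV[R[i]]_J) k :
  (v *m (trunc D J - 1%:M)^T) ord0 k = v ord0 k * (bmat D k k - 1)%:C.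
Proof.
rewrite mxE (bigD1 k) //= big1 ?addr0.
  by rewrite !mxE eqxx mulr1n (rmorphB (real_complex R)) (rmorph1 (real_complex R)).
move=> i ik; rewrite !mxE bmat_offdiag 1?eq_sym //.
by rewrite (negbTE ik) subr0 mulr0.
Qed.

(** Let $v$ be in both subspaces. As $v$ is in the kernel, $v_k(B_{kk}-1)=0$. If $B_{kk}=1$, then
    $v_k=w_k(B_{kk}-1)=0$, since $v$ is the image of some $w$. *)
Lemma trunc_direct_diagonal J : trunc_direct D J.
Proof.
apply/eqP; rewrite -submx0; apply/rV_subP => v.
rewrite sub_capmx => /andP[/sub_kermxP vA0 /submxP[w vE]].
rewrite submx0; apply/eqP/rowP => k; rewrite mxE.
move/rowP/(_ k): vA0; rewrite trunc_subr1_diag mxE => /eqP.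
by rewrite mulf_eq0 => /orP[/eqP//|/eqP b0]; rewrite vE trunc_subr1_diag b0 mulr0.
Qed.

Lemma trunc_proj_coord J (u : 'cV[R[i]]_J) (k : 'I_J) :
  bmat D k k != 1 -> (trunc_proj D J *m u) k ord0 = 0.
Proof.
(* Transposing gives the row vector [u^T] times [proj_mx], which lies in the row space
   [trunc_ker D J]. *)
move=> bk; rewrite /trunc_proj -[u]trmxK -trmx_mul mxE.
have /sub_kermxP/rowP/(_ k) :=
  proj_mx_sub (trunc_ker D J) (trunc_im D J) u^T.
rewrite trunc_subr1_diag [X in _ = X]mxE => /eqP; rewrite mulf_eq0 => /orP[/eqP//|].
by rewrite (fmorph_eq0 (real_complex R)) subr_eq0 (negbTE bk).
Qed.

Lemma trunc_entropy_diagonal J : trunc_entropy D J = 0.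
Proof.
rewrite /trunc_entropy big1 ?oppr0 // => j _; rewrite big1 // => k _.
have [->|jk] := eqVneq j k; last first.
  by rewrite bmat_offdiag // mulr0 !mul0r.
have [->|bk] := eqVneq (bmat D k k) 1; first by rewrite ln1 mulr0.
by rewrite trunc_proj_coord // mulr0 mul0r.
Qed.

Section Partition.
Variable chi : fin_partition.
Local Notation K := (last_block chi).

(** One jump $j_{i+1}\ne j_i$ yields a zero factor, so only constant paths remain; the one at $x$
    makes $n$ transitions, each of weight $B_{xx}$. *)
Lemma path_weight_diagonal n (s : {ffun 'I_n.+1 -> 'I_K.+1}) :
  path_weight D s = fine (\esum_(x in [set: nat])
    ((\prod_(i < n.+1) \1_(chi (s i)) x) * bmat D x x ^+ n * mu x)%:E)%E.
Proof.
rewrite /path_weight (esum_ffun_const _ _ _ ord0) => [|j].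
  congr fine; apply: eq_esum => x _; congr (_ * _ * _)%:E.
  - by apply: eq_bigr => i _; rewrite ffunE.
  - by under eq_bigr do rewrite !ffunE; rewrite prodr_const card_ord.
  - by rewrite ffunE.
rewrite eqe !mulf_eq0 !negb_or -andbA => /and3P[_ jb _].
apply: ffun_ord_const => i; apply/eqP; move: jb; apply: contraNT => ji.
by rewrite (bigD1 i) //= bmat_offdiag // mul0r.
Qed.

(** The indicators and $B_{xx}^n$ lie in $[0,1]$, so the sum is dominated by $\sum_x\mu_x=1$. *)
Lemma path_weight_bounds n (s : {ffun 'I_n.+1 -> 'I_K.+1}) :
  0 <= path_weight D s <= 1.
Proof.
rewrite path_weight_diagonal.
set F := (X in esum _ X).
have F0 x : (0 <= F x)%E.
  have mu0 : 0 <= mu x by exact/ltW/wt_gt0.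
  rewrite /F lee_fin (mulr_ge0 (mulr_ge0 _ (exprn_ge0 _ (bmat_ge0 x x)))) //.
  by apply: prodr_ge0 => i _; rewrite indicE.
have S0 : (0 <= \esum_(x in [set: nat]) F x)%E by apply: esum_ge0.
have S1 : (\esum_(x in [set: nat]) F x <= 1)%E.
  rewrite -(wt_sum1 mu); apply: le_esum => x _; rewrite /F lee_fin.
  rewrite ger_pMl ?wt_gt0 // mulr_ile1 ?exprn_ge0 ?exprn_ile1 ?bmat_ge0 //.
  - by apply: prodr_ge0 => i _; rewrite indicE.
  - by apply: prodr_ile1 => i _; rewrite indicE ler0n lern1 leq_b1.
  - exact: bmat_diag_le1.
by case: (\esum_(x in _) _)%E S0 S1 => [r| |] //=; rewrite !lee_fin => -> ->.
Qed.

(** Blocks are disjoint: if [s i] differs from [s ord0], no $x$ lies in both blocks, and one of the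
    two indicators vanishes. *)
Lemma path_weight_nonconst n (s : {ffun 'I_n.+1 -> 'I_K.+1}) :
  s != [ffun=> s ord0] -> path_weight D s = 0.
Proof.
move=> sN; rewrite path_weight_diagonal esum1 // => x _.
have [i si] : exists i, s i != s ord0.
  apply/existsP; rewrite -negb_forall; apply: contra sN => /forallP sE.
  by apply/eqP/ffunP => i; rewrite ffunE; exact/eqP.
have [_ tI _] : partition [set: 'I_K.+1] chi [set: nat] by case: (chi).
have [xi|xi] := pselect (chi (s i) x); last first.
  by rewrite (bigD1 i) //= indicE memNset // !mul0r.
rewrite (bigD1 ord0) //= indicE memNset ?mul0r // => x0.
by move/eqP: si; apply; apply: tI => //; exists x.
Qed.

Lemma entropy_n_bounds n : 0 <= entropy_n D chi n <= K.+1%:R.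
Proof.
(* Grouping by the value at $0$ leaves one constant [s] per group, hence $K+1$ terms. *)
rewrite /entropy_n (partition_big (fun s : {ffun _ -> _} => s ord0) xpredT) //=.
under eq_bigr => c _.
  rewrite (bigD1 [ffun=> c]) /=; last by rewrite ffunE.
  rewrite big1 ?addr0 => [|s /andP[/eqP sc sN]]; last first.
    by rewrite path_weight_nonconst ?mul0r // sc.
  over.
rewrite -sumrN sumr_ge0 /= => [|c _]; last first.
  by have /andP[] := entropy_term_bounds _ _ (path_weight_bounds n [ffun=> c]).
rewrite -[leRHS]/(1 *+ K.+1) -[X in _ *+ X]card_ord -sumr_const.
apply: ler_sum => c _.
by have /andP[] := entropy_term_bounds _ _ (path_weight_bounds n [ffun=> c]).
Qed.

Lemma cvg_entropy_rate : entropy_rate D chi @ \oo --> 0.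
Proof.
(* The shift skips $n=0$ and matches [harmonic n], which is $1/(n+1)$. *)
rewrite -cvg_shiftS.
apply: (@squeeze_cvgr _ _ _ _ (fun=> 0) (fun n => harmonic n * K.+1%:R)).
- apply: nearW => n; have /andP[h0 h1] := entropy_n_bounds n.+1.
  by rewrite mulr_ge0 ?invr_ge0 //= ler_wpM2l ?invr_ge0.
- exact: cvg_cst.
- rewrite -[X in _ --> X](mul0r K.+1%:R).
  by apply: cvgMl; exact: cvg_harmonic.
Qed.

End Partition.

End Diagonal.

(** The one-block partition shows that the supremum defining [entropy] is over a nonempty set, so
    that it is $0$ and not $-\infty$. *)
Lemma partition_setT : partition [set: 'I_1] (fun=> [set: nat]) [set: nat].
Proof.
split=> [|i j _ _ _|i _]; last by exists 0%N.
- by apply/seteqP; split=> // x _; exists ord0.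
- by rewrite !ord1.
Qed.

Theorem lemma9p1 (R : realType) (mu : weight R)
    (D : {linear hilb mu -> hilb mu}) :
  contractive D -> diagonal_op D ->
  ((forall J : nat, trunc_direct D J) /\
   cvgn (trunc_entropy D) /\
   lim_trunc_entropy D = 0) /\
  ((forall chi : fin_partition, cvgn (entropy_rate D chi)) /\
   entropy D = 0%E).
Proof.
move=> Dc Dd; split; split.
- exact: trunc_direct_diagonal.
- have h0 : trunc_entropy D @ \oo --> (0 : R[i]^o).
    rewrite (_ : trunc_entropy D = fun=> 0); first exact: cvg_cst.
    by apply/funext => J; exact: trunc_entropy_diagonal.
  by split; [apply/cvg_ex; exists 0|exact: cvg_lim h0].
- by move=> chi; apply/cvg_ex; exists 0; exact: cvg_entropy_rate.
- rewrite /entropy (_ : [set _ | _ in _] = [set 0%E]) ?ereal_sup1 //.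
  have h0 chi : entropy_part D chi = 0.
    by apply: cvg_lim => //; exact: cvg_entropy_rate.
  apply/seteqP; split=> [_ [chi _ <-]|_ ->] /=; first by rewrite h0.
  by exists (FinPartition partition_setT); rewrite ?h0.
Qed.
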